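(* Let $m\ge0$ and $n\ge 0$. If $m$ is odd, then \[ u_m(u_m(n))=2u_m(n)+1-c_m(n),\quad v_m(v_m(n))=2v_m(n)+c_m(n), \] \[ u_m(v_m(n))=2v_m(n)+1-c_m(n),\quad v_m(u_m(n))=2u_m(n)+c_m(n). \] If $m$ is even, then \[ u_m(u_m(n))=2u_m(n)+c_m(n),\quad v_m(v_m(n))=2v_m(n)+c_m(n), \] \[ u_m(v_m(n))=2v_m(n)+1-c_m(n),\quad v_m(u_m(n))=2u_m(n)+1-c_m(n). \]
   Context: For $n\ge0$ write $b_p(n)=\lfloor n/2^p\rfloor\bmod 2$; $\oplus$ is XOR and $\&$ is bitwise AND. For $m\ge0$ let $a_m(n)=\bigoplus_{p\ge0,\ p\,\&\,m=0} b_p(n)$. Let $v_m(n)$ (resp. $u_m(n)$), $n\ge0$, be the $n$-th (starting from index $0$) nonnegative integer $k$, in increasing order, with $a_m(k)=0$ (resp. $a_m(k)=1$). Let $K(m)=\max(1,\lceil\log_2(m+1)\rceil)$. The correction set $C(m)\subseteq\mathbb N$ is defined recursively: $C(0)=\emptyset$; for odd $m\ge1$, with $K=K(m)$ and $r=m-2^{K-1}$, $C(m)$ is periodic with period $2^K$ and $C(m)\cap[0,2^K)=\{2^K-2\}\cup\bigl(C(r)\cap[0,2^{K-1}-2)\bigr)$; for even $m\ge2$, $C(m)=C(m-1)$. The correction function is $c_m(n)=\bigoplus_{p\in C(m)} b_p(n)$. *)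

(* Defs.v *)
From mathcomp Require Import all_boot.

Set Implicit Arguments.
Unset Strict Implicit.
Unset Printing Implicit Defensive.

Definition bit (p n : nat) : bool := odd (n %/ 2 ^ p).

Lemma bit_ge p n : n <= p -> bit p n = false.
Proof.
by move=> np; rewrite /bit divn_small // (leq_ltn_trans np) // ltn_expl.
Qed.

(* The XOR of the bits b_p(n) over all p >= 0 in S; the range p < n loses
   nothing, by bit_ge. *)
Definition xor_bits (S : pred nat) (n : nat) : bool :=
  \big[addb/false]_(p < n | S p) bit p n.

Lemma xor_bits_widen (S : pred nat) n N : n <= N ->
  xor_bits S n = \big[addb/false]_(p < N | S p) bit p n.
Proof.
move=> nN; rewrite /xor_bits (big_ord_widen_cond _ _ (fun p => bit p n) nN).
rewrite [RHS](bigID (fun p : 'I_N => p < n)) /=.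
rewrite [X in _ (+) X]big1 ?addbF // => p /andP[_].
by rewrite -leqNgt; apply: bit_ge.
Qed.

Definition a (m : nat) : nat -> bool :=
  xor_bits (fun p => Nat.land p m == 0).

Definition unbounded (P : pred nat) : Prop :=
  forall N, exists k, (N <= k) && P k.

(* The elements of P in increasing order, indexed from 0. *)
Fixpoint enum_nat (P : pred nat) (infP : unbounded P) (n : nat) : nat :=
  if n is n'.+1 then ex_minn (infP (enum_nat infP n').+1)
  else ex_minn (infP 0).

Lemma a_double m k (b : bool) : a m (b + k.*2) = b (+) a m k.*2.
Proof.
suff E (d : bool) : a m (d + k.*2) =
    d (+) \big[addb/false]_(p < k.*2 | Nat.land p.+1 m == 0) bit p k.
  by rewrite E (E false).
have le_k : d + k.*2 <= k.*2.+1 by case: d.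
rewrite /a (xor_bits_widen _ le_k) big_mkcond big_ord_recl /= /bit divn1 oddD.
rewrite odd_double oddb addbF [in RHS]big_mkcond; congr (_ (+) _).
apply: eq_bigr => p _; rewrite /bump add1n.
by rewrite expnS divnMA divn2 half_bit_double.
Qed.

Lemma a_unbounded m (b : bool) : unbounded (fun k => a m k == b).
Proof.
move=> N; exists ((b (+) a m N.*2) + N.*2).
rewrite a_double -addbA addbb addbF eqxx andbT.
by rewrite -addnn addnA leq_addl.
Qed.

Definition v (m : nat) : nat -> nat := enum_nat (a_unbounded m false).
Definition u (m : nat) : nat -> nat := enum_nat (a_unbounded m true).

(* up_log 2 j is the ceiling of log_2 j. *)
Definition K (m : nat) : nat := maxn 1 (up_log 2 m.+1).

(* The recursion on m is bounded by fuel, for which m is enough; C_odd and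
   C_even are the defining equations. For K m = 1 the interval
   [0, 2 ^ (K m - 1) - 2) is empty, which truncated subtraction respects. *)
Fixpoint C_rec (fuel m p : nat) : bool :=
  if fuel is fuel'.+1 then
    if m == 0 then false
    else if odd m then
      let q := p %% 2 ^ K m in
      (q == 2 ^ K m - 2) ||
        (q < 2 ^ (K m - 1) - 2) && C_rec fuel' (m - 2 ^ (K m - 1)) q
    else C_rec fuel' (m - 1) p
  else false.

Definition C (m : nat) : pred nat := C_rec m m.

Lemma C_rec_fuel f m : m <= f -> C_rec f m =1 C m.
Proof.
suff H g : m <= f -> m <= g -> C_rec f m =1 C_rec g m by move=> mf; apply: H.
elim: f m g => [|f IH] [|m] [|g] //= mf mg p.
have le_sub j h : 0 < j -> m.+1 <= h.+1 -> m.+1 - j <= h.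
  by move=> j0 mh; rewrite leq_subLR (leq_trans mh) // -add1n leq_add2r.
case: ifP => _; last by apply: IH; apply: le_sub.
by rewrite (IH _ g) //; apply: le_sub; rewrite ?expn_gt0.
Qed.

Lemma C_0 : C 0 =1 pred0.
Proof. by []. Qed.

Lemma C_odd m p : odd m ->
  C m p = let q := p %% 2 ^ K m in
    (q == 2 ^ K m - 2) ||
      (q < 2 ^ (K m - 1) - 2) && C (m - 2 ^ (K m - 1)) q.
Proof.
case: m => [//|m] om; rewrite {1}/C /= -[~~ odd m]/(odd m.+1) om.
by rewrite C_rec_fuel // leq_subLR -add1n leq_add2r expn_gt0.
Qed.

Lemma C_even m : 0 < m -> ~~ odd m -> C m =1 C (m - 1).
Proof.
case: m => [//|m] _ /negbTE om p; rewrite {1}/C /= -[~~ odd m]/(odd m.+1) om.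
by rewrite C_rec_fuel // subn1.
Qed.

Definition c (m : nat) : nat -> bool := xor_bits (C m).

(* Main.v *)
Require Import Defs.
From Stdlib Require Import PeanoNat.
From mathcomp Require Import all_boot.
From mathcomp Require Import zify.

Set Implicit Arguments.
Unset Strict Implicit.
Unset Printing Implicit Defensive.

(** Write [S] for the set of positions [p] with [p & m = 0]. Exactly one of
    [2k], [2k+1] has [a_m = 0], so [v_m k = 2k + d] and [u_m k = 2k + 1 - d],
    where [d] is the XOR of the bits of [k] at the positions in [S - 1].
    Applying this twice reduces all identities to a description of [C(m)]:
    it is [S - 2] for odd [m], and the symmetric difference of [S - 1] and
    [S - 2] for even [m]. The odd case follows by splitting off the top bit of
    [m]; the even case then reduces to the identity [disjoint_bits_pred]. *)

Definition disjoint_bits (x m : nat) : bool := Nat.land x m == 0.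

Lemma half_land x y : (Nat.land x y)./2 = Nat.land x./2 y./2.
Proof.
have H z : z./2 = Nat.div2 z.
  have [k] := ubnP z; elim: k z => // k IH [|[|z]] //= zk.
  by rewrite IH //; lia.
by rewrite !H !Nat.div2_spec Nat.shiftr_land.
Qed.

Lemma odd_land x y : odd (Nat.land x y) = odd x && odd y.
Proof.
have H z : odd z = Nat.testbit z 0.
  rewrite Nat.bit0_odd; elim: z => // z /= ->.
  by rewrite Nat.odd_succ -Nat.negb_odd.
by rewrite !H Nat.land_spec.
Qed.

Lemma disjoint_bits_double (b d : bool) x m :
  disjoint_bits (b + x.*2) (d + m.*2) = ~~ (b && d) && disjoint_bits x m.
Proof.
rewrite /disjoint_bits -[Nat.land (b + _) _]odd_double_half half_land odd_land.
rewrite !oddD !odd_double !addbF !oddb !half_bit_double.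
by rewrite addn_eq0 double_eq0; case: (b && d).
Qed.

Lemma disjoint_bits0 m : disjoint_bits 0 m.
Proof. by []. Qed.

Lemma disjoint_bitsn0 x : disjoint_bits x 0.
Proof. by rewrite /disjoint_bits Nat.land_0_r. Qed.

Lemma disjoint_bits_split k i j x y : x < 2 ^ k -> y < 2 ^ k ->
  disjoint_bits (i * 2 ^ k + x) (j * 2 ^ k + y) =
    disjoint_bits i j && disjoint_bits x y.
Proof.
elim: k x y => [|k IH] x y.
  rewrite expn0 !ltnS !leqn0 => /eqP-> /eqP->.
  by rewrite !muln1 !addn0 andbT.
rewrite expnS => xk yk.
have E l z : l * (2 * 2 ^ k) + z = odd z + (l * 2 ^ k + z./2).*2.
  by rewrite -{1}(odd_double_half z) doubleD addnCA mulnCA mul2n.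
rewrite !E disjoint_bits_double IH; [|lia|lia].
rewrite -[x in RHS]odd_double_half -[y in RHS]odd_double_half.
by rewrite disjoint_bits_double andbCA.
Qed.

(** Pascal's rule modulo 2: by Kummer's theorem, [disjoint_bits y m] holds exactly when the binomial
    coefficient of [y + m] over [m] is odd. The lowest bits settle every case except [y] and [m]
    both even, which passes to the halves. *)
Lemma disjoint_bits_pred y m : 0 < m -> 0 < y ->
  disjoint_bits y m (+) disjoint_bits y.-1 m = disjoint_bits y m.-1.
Proof.
have [k] := ubnP m; elim: k m y => // k IH m y mk m0 y0.
have split_pred (b : bool) z :
    0 < b + z.*2 -> (b + z.*2).-1 = ~~ b + (if b then z else z.-1).*2.
  by case: b; lia.
move: mk m0 y0; rewrite -(odd_double_half m) -(odd_double_half y).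
move: (odd m) (odd y) m./2 y./2 => d b {}m {}y mk m0 y0.
rewrite !split_pred // !disjoint_bits_double.
case: d b mk m0 y0 => [] [] /= mk m0 y0; rewrite ?addbF ?addbb //.
by apply: IH; lia.
Qed.

(** [K m] is the number of binary digits of [m], so [2 ^ (K m).-1] is its leading bit. *)
Lemma expn_K m : 0 < m -> K m = (K m).-1.+1 /\ 2 ^ (K m).-1 <= m < 2 ^ K m.
Proof.
move=> m0; have /andP[lo hi] := up_log_bounds (isT : 1 < 2) (m0 : 1 < m.+1).
have K0 : 0 < up_log 2 m.+1 by rewrite up_log_gt0.
by rewrite /K (maxn_idPr K0) prednK // -ltnS lo.
Qed.

Lemma mem_C_odd m p : odd m -> C m p = disjoint_bits p.+2 m.
Proof.
have [f] := ubnP m; elim: f m p => // f IH m p mf om.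
have m0 : 0 < m by case: (m) om.
have [kE /andP[lo hi]] := expn_K m0.
rewrite C_odd //= subn1; move: (K m).-1 kE lo hi => k -> lo hi.
set q := p %% _.
have qk : q < 2 ^ k.+1 by rewrite ltn_pmod ?expn_gt0.
have two_pow : 2 ^ k.+1 = 2 ^ k + 2 ^ k by rewrite expnS mul2n addnn.
(* As [m < 2 ^ k.+1], only the residue of [p.+2] matters; [q.+2] itself may overflow. *)
have -> : disjoint_bits p.+2 m = disjoint_bits (q.+2 %% 2 ^ k.+1) m.
  rewrite -[q.+2]addn2 modnDml addn2 {1}(divn_eq p.+2 (2 ^ k.+1)).
  rewrite -[m in LHS](add0n m) -(mul0n (2 ^ k.+1)).
  by rewrite disjoint_bits_split ?ltn_pmod ?expn_gt0 // disjoint_bitsn0.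
(* Here [q.+2] wraps around to 0, which shares no bit with [m]: the element adjoined explicitly. *)
have [qE|qN] := eqVneq q (2 ^ k.+1 - 2).
  have k0 := expn_gt0 2 k.
  have -> : q.+2 = 2 ^ k.+1 by lia.
  by rewrite modnn.
have [q2|q2] := ltnP q.+2 (2 ^ k.+1); last first.
  (* Now [q.+2] wraps around to 1, a bit of the odd number [m]. *)
  have qE : q.+2 = 2 ^ k.+1 + 1 by have := expn_gt0 2 k; lia.
  have -> : (q < 2 ^ k - 2) = false by lia.
  rewrite qE modnDl -(odd_double_half m) om.
  have -> : 1 %% 2 ^ k.+1 = true + 0.*2 by rewrite modn_small //; lia.
  by rewrite disjoint_bits_double.
have k_gt0 : 0 < k by case: (k) q2.
rewrite (modn_small q2) /=.
have top_bit i x : x < 2 ^ k ->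
    disjoint_bits (i * 2 ^ k + x) m =
      disjoint_bits i 1 && disjoint_bits x (m - 2 ^ k).
  move=> xk; rewrite -{1}(subnKC lo) -{2}(mul1n (2 ^ k)).
  by rewrite disjoint_bits_split //; lia.
(* Below [2 ^ k], [q.+2] misses the top bit of [m] and induction applies to [m - 2 ^ k]; otherwise
   it shares that bit. *)
have [q2k|q2k] := ltnP q.+2 (2 ^ k).
  have -> : q < 2 ^ k - 2 by lia.
  rewrite IH; first last.
  - by rewrite oddB // om oddX orbF -leqn0 leqNgt k_gt0.
  - by have := expn_gt0 2 k; lia.
  by have := top_bit 0 _ q2k; rewrite mul0n add0n => ->.
have -> : (q < 2 ^ k - 2) = false by lia.
have -> : q.+2 = 1 * 2 ^ k + (q.+2 - 2 ^ k) by lia.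
by rewrite top_bit //; lia.
Qed.

Lemma mem_C_even m p : ~~ odd m ->
  C m p = disjoint_bits p.+1 m (+) disjoint_bits p.+2 m.
Proof.
case: (posnP m) => [-> _|m0 em]; first by rewrite C_0 !disjoint_bitsn0.
rewrite C_even // mem_C_odd; last by rewrite subn1; lia.
by rewrite subn1 addbC -disjoint_bits_pred.
Qed.

Lemma eq_xor_bits (S T : pred nat) n : S =1 T -> xor_bits S n = xor_bits T n.
Proof. by move=> ST; apply: eq_bigl => p; apply: ST. Qed.

Lemma xor_bits_addb (S T : pred nat) n :
  xor_bits S n (+) xor_bits T n = xor_bits (fun p => S p (+) T p) n.
Proof.
rewrite /xor_bits big_mkcond [X in _ (+) X]big_mkcond [RHS]big_mkcond.
rewrite -big_split /=.
by apply: eq_bigr => p _; case: (S p) (T p) (bit p n) => [] [] [].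
Qed.

Lemma xor_bits_double (S : pred nat) (e : bool) n :
  xor_bits S (e + n.*2) = (S 0 && e) (+) xor_bits (S \o succn) n.
Proof.
have le1 : e + n.*2 <= n.*2.+1 by case: e.
have le2 : n <= n.*2 by lia.
rewrite (xor_bits_widen _ le1) (xor_bits_widen _ le2).
rewrite big_mkcond big_ord_recl [in RHS]big_mkcond /=; congr addb.
  by rewrite /bit divn1 oddD odd_double oddb addbF; case: (S 0).
apply: eq_bigr => p _; rewrite /bump add1n /bit.
by rewrite expnS divnMA divn2 half_bit_double.
Qed.

(** Monotonicity leaves no element of [P] between [f n] and [f n.+1], so the least next element is
    [f n.+1]. This yields closed formulas for [u] and [v]. *)
Lemma enum_natE (P : pred nat) (infP : unbounded P) (f : nat -> nat) :
    (forall n, P (f n)) -> (forall k, P k -> exists n, k = f n) ->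
    (forall n, f n < f n.+1) ->
  enum_nat infP =1 f.
Proof.
move=> Pf surj f_lt.
have mono : {mono f : i j / i <= j}.
  by apply: leq_mono; apply: homo_ltn f_lt => y x z; apply: ltn_trans.
elim=> [|n IH] /=; case: ex_minnP => k.
  move=> /= Pk min_k; apply/eqP; have [i ki] := surj k Pk.
  by rewrite eqn_leq min_k ?Pf // ki mono.
case/andP; rewrite IH => lek Pk min_k; apply/eqP; have [i ki] := surj k Pk.
move: lek; rewrite ki (leqW_mono mono) => ni.
by rewrite eqn_leq [f n.+1 <= _]mono ni andbT -ki min_k // Pf f_lt.
Qed.

(** This is [a m k.*2] as a function of [k]. *)
Definition shifted_xor m := xor_bits (fun p => disjoint_bits p.+1 m).

Lemma a_shifted m (b : bool) k : a m (b + k.*2) = b (+) shifted_xor m k.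
Proof. exact: xor_bits_double. Qed.

Lemma enum_a m (b : bool) n :
  enum_nat (a_unbounded m b) n = (b (+) shifted_xor m n) + n.*2.
Proof.
move: n; apply: enum_natE => [n|k|n].
- by rewrite a_shifted -addbA addbb addbF.
- rewrite -{1}(odd_double_half k) a_shifted => /eqP<-; exists k./2.
  by rewrite -addbA addbb addbF odd_double_half.
(* The values at [n] and [n.+1] lie in consecutive disjoint pairs. *)
- by case: (b (+) _) (b (+) _) => [] [] /=; lia.
Qed.

(** The low bit [e] counts when 1 shares no bit with [m], that is for even [m]; the other bits move
    down one position. *)
Lemma shifted_xor_double m (e : bool) n :
  shifted_xor m (e + n.*2) =
    (~~ odd m && e) (+) xor_bits (fun p => disjoint_bits p.+2 m) n.
Proof.
rewrite /shifted_xor xor_bits_double; congr (_ && _ (+) _).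
rewrite -(odd_double_half m) (disjoint_bits_double true _ 0) disjoint_bits0.
by rewrite andbT oddD odd_double oddb addbF.
Qed.

(** For even [m] the low bit of the enumerated value contributes [b] and an XOR over the positions
    of [shifted_xor]; the latter completes [C m]. For odd [m] it is not counted. *)
Lemma shifted_xor_enum_a m (b : bool) n :
  shifted_xor m (enum_nat (a_unbounded m b) n) = (~~ odd m && b) (+) c m n.
Proof.
rewrite enum_a shifted_xor_double /c; case: (boolP (odd m)) => om /=.
  by apply: eq_xor_bits => p; rewrite mem_C_odd.
rewrite -addbA xor_bits_addb; congr addb.
by apply: eq_xor_bits => p; rewrite mem_C_even.
Qed.

(* c m n : bool is coerced to 0 or 1 in nat. *)
Theorem theorem28 (m n : nat) :
  (odd m ->
    [/\ u m (u m n) = 2 * u m n + 1 - c m n,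
        v m (v m n) = 2 * v m n + c m n,
        u m (v m n) = 2 * v m n + 1 - c m n &
        v m (u m n) = 2 * u m n + c m n]) /\
  (~~ odd m ->
    [/\ u m (u m n) = 2 * u m n + c m n,
        v m (v m n) = 2 * v m n + c m n,
        u m (v m n) = 2 * v m n + 1 - c m n &
        v m (u m n) = 2 * u m n + 1 - c m n]).
Proof.
have uE k : u m k = ~~ shifted_xor m k + k.*2 by rewrite /u enum_a.
have vE k : v m k = shifted_xor m k + k.*2 by rewrite /v enum_a.
have suE : shifted_xor m (u m n) = ~~ odd m (+) c m n.
  by rewrite shifted_xor_enum_a andbT.
have svE : shifted_xor m (v m n) = c m n by rewrite shifted_xor_enum_a andbF.
rewrite !(uE (u m n)) !(uE (v m n)) !(vE (u m n)) !(vE (v m n)) suE svE.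
by split=> [-> | /negbTE->]; split; case: (c m n) => /=; lia.
Qed.
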